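(* For all integers $n\ge1$ and $k\ge0$, $$C_{n,k}=D_{n,k}+D_{n-1,k}+D_{n-1,k+1}.$$
   Context: A $01$ matrix is lonesum if it is uniquely determined among $01$ matrices of its size by its row sum vector and column sum vector; equivalently (Ryser), no $2\times 2$ submatrix (obtained by deleting rows and columns) equals $\begin{pmatrix}1&0\\0&1\end{pmatrix}$ or $\begin{pmatrix}0&1\\1&0\end{pmatrix}$. Empty matrices (with $0$ rows or $0$ columns) count as lonesum. $C_{n,k}$ is the number of lonesum $01$ matrices of size $n\times k$ in which every column contains at least one $1$ (so $C_{n,0}=1$). $D_{n,k}$ is the number of lonesum $01$ matrices of size $n\times k$ in which every column and every row contains at least one $1$; in particular $D_{0,0}=1$ and $D_{n,0}=D_{0,n}=0$ for $n\ge1$. *)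

(* Defs.v *)
From mathcomp Require Import all_boot all_order all_algebra.

Set Implicit Arguments.
Unset Strict Implicit.
Unset Printing Implicit Defensive.

(* A 01 matrix is a boolean matrix; the coercion bool >-> nat
   reads its entries as the numbers 0 and 1.  The dimensions may be 0, in which
   case there is exactly one (empty) matrix. *)

Definition row_sum (n k : nat) (A : 'M[bool]_(n, k)) (i : 'I_n) : nat :=
  \sum_(j < k) A i j.

Definition col_sum (n k : nat) (A : 'M[bool]_(n, k)) (j : 'I_k) : nat :=
  \sum_(i < n) A i j.

Definition lonesum (n k : nat) (A : 'M[bool]_(n, k)) : bool :=
  [forall B : 'M[bool]_(n, k),
    [forall i, row_sum B i == row_sum A i] &&
    [forall j, col_sum B j == col_sum A j] ==> (B == A)].

Definition cols_nonzero (n k : nat) (A : 'M[bool]_(n, k)) : bool :=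
  [forall j, exists i, A i j].

Definition rows_nonzero (n k : nat) (A : 'M[bool]_(n, k)) : bool :=
  [forall i, exists j, A i j].

Definition lonesumC (n k : nat) : nat :=
  #|[set A : 'M[bool]_(n, k) | lonesum A && cols_nonzero A]|.

Definition lonesumD (n k : nat) : nat :=
  #|[set A : 'M[bool]_(n, k) | [&& lonesum A, cols_nonzero A & rows_nonzero A]]|.

(* Main.v *)
Require Import Defs.
From mathcomp Require Import all_boot all_order all_algebra.
From mathcomp Require Import perm ring.

(** A 01 matrix is lonesum exactly when its columns, read as sets of rows, form
a chain for inclusion ([lonesum_chain]; [threshold_lonesum] gives the converse).
Suppose that the chain has J distinct members and that none is empty.  Give
column j the number [depth] of members strictly containing it, and row i the
number [height] of members to which i belongs.  Then entry (i, j) is 1 if and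
only if depth j < height i.  The depths take every value in 0, ..., J-1; the
heights lie in 0, ..., J, they take every positive value, and they take the
value 0 exactly when there is a zero row.  Conversely, every such pair of
functions is recovered from its threshold matrix.  So, if s(m, J) is the number
of surjections from m points onto J points, [card_threshold] gives

   D(n, k) = sum_J s(n, J) s(k, J),
   C(n, k) = sum_J (s(n, J) + s(n, J+1)) s(k, J),

where the two summands of C distinguish whether the height 0 is missed or
taken.  Hence C(n, k) - D(n, k) = sum_J s(n, J+1) s(k, J).  Removing one point
from the source of a surjection ([surjectionsSS]) gives

   s(m+1, J+1) = (J+1) (s(m, J) + s(m, J+1)),

and for n = m+1 this turns the difference into
sum_J (J+1) (s(m, J) + s(m, J+1)) s(k, J).  Applied to s(k+1, J+1) in D(m, k+1),
the same recurrence, followed by a shift of J in one of the two resulting sums,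
shows that D(m, k) + D(m, k+1) has the same value. *)

Set Implicit Arguments.
Unset Strict Implicit.
Unset Printing Implicit Defensive.

(** * Counting surjections *)

Definition onto n J (f : {ffun 'I_n -> 'I_J}) := [forall v, v \in codom f].

(** The value [v] may be taken or not. *)
Definition onto_but n J (v : 'I_J) (f : {ffun 'I_n -> 'I_J}) :=
  [forall w, (w != v) ==> (w \in codom f)].

Definition surjections n J := #|[set f : {ffun 'I_n -> 'I_J} | onto f]|.

Lemma ontoP n J (f : {ffun 'I_n -> 'I_J}) :
  reflect (forall v, exists i, f i = v) (onto f).
Proof.
apply: (iffP forallP) => H v; first by have /codomP[i ->] := H v; exists i.
by have [i <-] := H v; apply: codom_f.
Qed.

Lemma onto_butP n J v (f : {ffun 'I_n -> 'I_J}) :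
  reflect (forall w, w != v -> exists i, f i = w) (onto_but v f).
Proof.
apply: (iffP forall_inP) => H w wv; first by have /codomP[i ->] := H w wv; exists i.
by have [i <-] := H w wv; apply: codom_f.
Qed.

Lemma surjections_eq0 n J : n < J -> surjections n J = 0.
Proof.
move=> ltnJ; apply/eqP; rewrite cards_eq0 -subset0; apply/subsetP=> f.
rewrite inE => /forallP onf.
have : #|'I_J| <= #|codom f| by apply: subset_leq_card; apply/subsetP=> v _; apply: onf.
move=> /leq_trans/(_ (card_size _)).
by rewrite size_codom !card_ord leqNgt ltnJ.
Qed.

(** The functions hitting every value but [v] are the surjections onto J points
followed by [lift v], the increasing map that skips [v]. *)
Lemma card_onto_but_miss n J (v : 'I_J.+1) :
  #|[set f : {ffun 'I_n -> 'I_J.+1} | onto_but v f && (v \notin codom f)]|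
  = surjections n J.
Proof.
pose up (h : {ffun 'I_n -> 'I_J}) := [ffun i => lift v (h i)].
have up_inj : injective up.
  move=> h h' /ffunP e; apply/ffunP=> i.
  by have := e i; rewrite !ffunE => /lift_inj.
rewrite /surjections -(card_imset _ up_inj); congr #|pred_of_set _|.
apply/setP=> f; rewrite inE; apply/andP/imsetP => [[/onto_butP onf vf]|[h]].
  have lv i : v != f i.
    by apply: contraNneq vf => ->; apply: codom_f.
  pose h := [ffun i => s2val (unlift_some (lv i))] : {ffun 'I_n -> 'I_J}.
  have fE i : f i = lift v (h i).
    by rewrite ffunE; exact: (s2valP (unlift_some (lv i))).
  clearbody h; exists h; last by apply/ffunP=> i; rewrite [RHS]ffunE.
  rewrite inE; apply/ontoP=> w.
  have [|i] := onf (lift v w); first by rewrite eq_sym neq_lift.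
  by rewrite fE => /lift_inj; exists i.
rewrite inE => /ontoP onh ->; split.
  apply/onto_butP=> w; rewrite eq_sym => /unlift_some[u -> _].
  by have [i <-] := onh u; exists i; rewrite ffunE.
by apply/codomP=> -[i]; rewrite ffunE => /eqP; apply/negP/neq_lift.
Qed.

Lemma card_onto_but n J (v : 'I_J.+1) :
  #|[set f : {ffun 'I_n -> 'I_J.+1} | onto_but v f]|
  = surjections n J + surjections n J.+1.
Proof.
rewrite -(card_onto_but_miss n v) addnC.
rewrite -(cardsID [set f : {ffun 'I_n -> _} | v \in codom f]).
congr (_ + _); apply: eq_card => f; rewrite !inE; last by rewrite andbC.
apply/andP/ontoP => [[/onto_butP onf /codomP[i vi]] w|onf].
  by have [->|/onf//] := eqVneq w v; exists i.
by split; [apply/onto_butP=> w _ | have [i <-] := onf v; apply: codom_f].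
Qed.

Lemma surjectionsS0 n : surjections n.+1 0 = 0.
Proof. by apply: eq_card0 => f; case: (f ord0). Qed.

(** Once the value v at [ord0] is chosen, the rest of the function has to hit
every value except possibly v. *)
Lemma surjectionsSS n J :
  surjections n.+1 J.+1 = J.+1 * (surjections n J + surjections n J.+1).
Proof.
pose cons (p : 'I_J.+1 * {ffun 'I_n -> 'I_J.+1}) : {ffun 'I_n.+1 -> 'I_J.+1} :=
  [ffun i => oapp p.2 p.1 (unlift ord0 i)].
have consE0 p : cons p ord0 = p.1 by rewrite ffunE unlift_none.
have consES p i : cons p (lift ord0 i) = p.2 i by rewrite ffunE liftK.
have cons_inj : injective cons.
  move=> p q e; apply/eqP; rewrite -pair_eqE /= -!consE0 e eqxx.
  by apply/eqP/ffunP=> i; rewrite -!consES e.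
transitivity #|[set p : 'I_J.+1 * {ffun 'I_n -> 'I_J.+1} | onto_but p.1 p.2]|.
  rewrite -(card_imset _ cons_inj); congr #|pred_of_set _|.
  apply/setP=> f; rewrite inE; apply/ontoP/imsetP => [onf|[p]].
    pose p := (f ord0, [ffun i => f (lift ord0 i)] : {ffun 'I_n -> 'I_J.+1}).
    exists p; last first.
      apply/ffunP=> i; have [j ->|->] := unliftP ord0 i.
        by rewrite consES ffunE.
      by rewrite consE0.
    rewrite inE; apply/onto_butP=> w; have [i <-] := onf w.
    have [j -> _|->] := unliftP ord0 i; last by rewrite eqxx.
    by exists j; rewrite ffunE.
  rewrite inE => /onto_butP onp -> w.
  have [->|/onp[i <-]] := eqVneq w p.1; first by exists ord0; apply: consE0.
  by exists (lift ord0 i); apply: consES.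
rewrite -sum1dep_card -(pair_big_dep xpredT (fun v f => onto_but v f) (fun _ _ => 1)) /=.
under eq_bigr => v _ do rewrite sum1dep_card card_onto_but.
by rewrite sum_nat_const card_ord.
Qed.

(** * Lonesum matrices are those whose columns form a chain *)

Section Threshold.

Variables n k : nat.
Implicit Type A : 'M[bool]_(n, k).

(** A competitor B with the same margins gives the same value as A to every
weighted sum of entries with weight F i - G j, since this weight separates into
a row part and a column part.  When the weight is positive on the 1s of A and
negative on its 0s, A is the only maximiser of the sum, so B = A. *)
Lemma threshold_lonesum A (f : 'I_n -> nat) (g : 'I_k -> nat) :
  (forall i j, A i j = (g j < f i)) -> lonesum A.
Proof.
move=> AE; apply/forallP=> B; apply/implyP=> /andP[/forallP rB /forallP cB].
(* [2 f i - (2 g j + 1)] has the required sign and never vanishes, which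
   [f i - g j] itself could do at a 0 of A.  To remain in [nat], the negative
   terms are moved to the other side. *)
pose F i := (f i).*2; pose G j := (g j).*2.+1.
have le p : B p.1 p.2 * F p.1 + A p.1 p.2 * G p.2
    <= A p.1 p.2 * F p.1 + B p.1 p.2 * G p.2 ?= iff (B p.1 p.2 == A p.1 p.2).
  have FG : (F p.1 != G p.2) && ((G p.2 < F p.1) == A p.1 p.2).
    rewrite AE /F /G ltn_Sdouble eqxx andbT.
    by apply/negP=> /eqP/(congr1 odd); rewrite /= !odd_double.
  move: FG; case: (A _ _) (B _ _) => [] [] /andP[FG /eqP ltGF];
    rewrite ?mul1n ?mul0n ?addn0 ?add0n ?eqxx /=; split=> //.
  - exact: eqxx.
  - exact: ltnW.
  - by rewrite eq_sym (negPf FG).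
  - by rewrite leqNgt ltGF.
  - by rewrite (negPf FG).
have sumF : \sum_p B p.1 p.2 * F p.1 = \sum_p A p.1 p.2 * F p.1.
  rewrite -(pair_bigA _ (fun i j => B i j * F i)).
  rewrite -(pair_bigA _ (fun i j => A i j * F i)) /=.
  by apply: eq_bigr => i _; rewrite -!big_distrl /=; congr (_ * _); apply/eqP/rB.
have sumG : \sum_p B p.1 p.2 * G p.2 = \sum_p A p.1 p.2 * G p.2.
  rewrite -(pair_bigA _ (fun i j => B i j * G j)).
  rewrite -(pair_bigA _ (fun i j => A i j * G j)) /=.
  rewrite exchange_big [RHS]exchange_big /=.
  by apply: eq_bigr => j _; rewrite -!big_distrl /=; congr (_ * _); apply/eqP/cB.
have [_] := leqif_sum (P := xpredT) (fun p _ => le p).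
rewrite !big_split /= sumF sumG eqxx => /esym/forallP eAB.
by apply/eqP/matrixP=> i j; apply/eqP; have := eAB (i, j).
Qed.

Definition colset A j := [set i | A i j].

Definition colsets A := [set colset A j | j : 'I_k].

(** If columns j and j' are incomparable, some rows i and i' meet them in a 2 x 2
identity or antidiagonal pattern; exchanging its 0s and 1s preserves all sums
and changes the matrix. *)
Lemma lonesum_chain A j j' : lonesum A ->
  (colset A j \subset colset A j') || (colset A j' \subset colset A j).
Proof.
move=> /forallP loneA; apply/norP=> -[/subsetPn[i]]; rewrite !inE => Aij Aij'.
case/subsetPn=> i'; rewrite !inE => Ai'j' Ai'j.
pose rows := [set i; i']; pose cols := [set j; j'].
pose B : 'M[bool]_(n, k) :=
  (\matrix_(x, y) A x (if x \in rows then tperm j j' y else y))%R.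
(* The exchange, defined as a swap of two columns on [rows], is also a swap of
   two rows on [cols]: the first form makes the row sums obvious, the second the
   column sums. *)
have BE x y : B x y = A (if y \in cols then tperm i i' x else x) y.
  rewrite mxE !inE.
  have [->|nyj] := eqVneq y j; [|have [->|nyj'] := eqVneq y j'];
  (have [->|nxi] := eqVneq x i; [|have [->|nxi'] := eqVneq x i']);
  rewrite /= ?tpermL ?tpermR ?tpermD // 1?eq_sym //;
  by rewrite ?Aij ?(negPf Aij') ?Ai'j' ?(negPf Ai'j).
have := loneA B; rewrite implybE; case/orP=> [/negP[]|/eqP/matrixP/(_ i j)].
  apply/andP; split; apply/forallP=> x; apply/eqP.
    rewrite /row_sum; case xr: (x \in rows).
      rewrite [RHS](reindex_inj (@perm_inj _ (tperm j j'))) /=.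
      by apply: eq_bigr => y _; rewrite mxE xr.
    by apply: eq_bigr => y _; rewrite mxE xr.
  rewrite /col_sum; case xc: (x \in cols).
    rewrite [RHS](reindex_inj (@perm_inj _ (tperm i i'))) /=.
    by apply: eq_bigr => y _; rewrite BE xc.
  by apply: eq_bigr => y _; rewrite BE xc.
by rewrite mxE !inE eqxx tpermL Aij (negPf Aij').
Qed.

(** * Recovering a lonesum matrix from the depths and heights *)

Definition depth A j := #|[set S in colsets A | colset A j \proper S]|.

Definition height A i := #|[set S in colsets A | i \in S]|.

Lemma mem_colset A j : colset A j \in colsets A.
Proof. exact: imset_f. Qed.

Lemma depth_lt A j : depth A j < #|colsets A|.
Proof.
apply: proper_card; apply/properP; split; first by apply/subsetP=> S; rewrite inE; case/andP.
by exists (colset A j); rewrite ?mem_colset // inE properxx andbF.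
Qed.

Lemma height_lt A i : height A i < #|colsets A|.+1.
Proof. by apply: subset_leq_card; apply/subsetP=> S; rewrite inE; case/andP. Qed.

(** If i lies in column j, it lies in all columns strictly above column j and in
column j itself.  If not, the columns containing i are not inside column j, so
by the chain condition they lie strictly above it. *)
Lemma lonesum_depth_height A i j : lonesum A -> A i j = (depth A j < height A i).
Proof.
move=> loneA; apply/idP/idP => [Aij|]; last first.
  apply: contraTT => nAij; rewrite -leqNgt; apply: subset_leq_card.
  apply/subsetP=> S; rewrite !inE => /andP[/imsetP[j' _ ->]]; rewrite inE => Aij'.
  rewrite mem_colset /= properE; have := lonesum_chain j j' loneA.
  have nsub : ~~ (colset A j' \subset colset A j).
    by apply/subsetPn; exists i; rewrite inE.
  by rewrite (negPf nsub) orbF => ->.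
apply: proper_card; apply/properP; split.
  apply/subsetP=> S; rewrite !inE => /andP[-> /proper_sub/subsetP]; apply.
  by rewrite inE.
by exists (colset A j); rewrite !inE mem_colset ?properxx ?andbF.
Qed.

(** Column j is determined by its depth, so there are at least as many depths as
distinct columns; all depths are below that number. *)
Lemma depth_onto A v : lonesum A -> v < #|colsets A| -> exists j, depth A j = v.
Proof.
move=> loneA ltv; pose d j := Ordinal (depth_lt A j).
suff /imsetP[j _ e] : Ordinal ltv \in [set d j | j : 'I_k].
  by exists j; rewrite -[v]/(val (Ordinal ltv)) e.
suff -> : [set d j | j : 'I_k] = setT by [].
apply/eqP; rewrite eqEcard subsetT cardsT card_ord /=.
pose L (v : 'I_#|colsets A|) : {set 'I_n} := [set i | v < height A i].
apply: leq_trans (leq_imset_card L _); apply: subset_leq_card.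
apply/subsetP=> _ /imsetP[j _ ->]; apply/imsetP; exists (d j); rewrite ?imset_f //.
by apply/setP=> i; rewrite !inE lonesum_depth_height.
Qed.

(** Height v is that of any row which belongs to the column of depth v-1 but not
to the next smaller column of the chain; when v-1 is the largest depth there is no
smaller column, and such a row exists because the column is not zero. *)
Lemma height_onto_but A v : lonesum A -> cols_nonzero A ->
  0 < v <= #|colsets A| -> exists i, height A i = v.
Proof.
move=> loneA /forallP nzA /andP[v0 lev].
have [j dj] : exists j, depth A j = v.-1 by apply: depth_onto; rewrite ?prednK.
have [ltv|gev] := ltnP v #|colsets A|; last first.
  have /existsP[i] := nzA j; rewrite lonesum_depth_height // dj prednK // => hi.
  exists i; apply/eqP; rewrite eqn_leq hi andbT.
  by apply: leq_trans gev; rewrite -ltnS height_lt.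
have [j' dj'] := depth_onto loneA ltv.
have /subsetPn[i] : ~~ (colset A j \subset colset A j').
  have := lonesum_chain j j' loneA; apply: contraL => sjj'.
  suff : depth A j' <= depth A j by rewrite dj dj' leqNgt prednK ?leqnn.
  apply: subset_leq_card; apply/subsetP=> S; rewrite !inE => /andP[-> /=].
  exact: sub_proper_trans.
rewrite !inE !lonesum_depth_height // dj dj' prednK // -leqNgt => h1 h2.
by exists i; apply/eqP; rewrite eqn_leq h2 h1.
Qed.

(** * Threshold matrices and their enumeration *)

Definition threshold J (p : {ffun 'I_n -> 'I_J.+1} * {ffun 'I_k -> 'I_J}) :=
  (\matrix_(i, j) (p.2 j < p.1 i)%N)%R : 'M[bool]_(n, k).

Section Levels.

Variables (J : nat) (f : {ffun 'I_n -> 'I_J.+1}) (g : {ffun 'I_k -> 'I_J}).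
Hypotheses (fP : onto_but ord0 f) (gP : onto g).

Let A := threshold (f, g).
(* [L v] is the common row set of the columns of depth [v]. *)
Let L (v : 'I_J) := [set i | v < f i].

(** Strictness of this chain is where the values 1, ..., J of [f] are needed: a
row of height v+1 separates level v from the lower ones. *)
Lemma level_proper v w : (L w \proper L v) = (v < w).
Proof.
apply/idP/idP => [/properP[_ [i]]|ltvw].
  by rewrite !inE -leqNgt => vf fw; apply: leq_trans fw.
apply/properP; split.
  by apply/subsetP=> i; rewrite !inE; apply: ltn_trans.
have /onto_butP/(_ (lift ord0 v) isT)[i fi] := fP.
by exists i; rewrite inE fi /= /bump /= add1n // -leqNgt.
Qed.

Lemma level_inj : injective L.
Proof.
move=> v w e; apply/val_inj; case: (ltngtP v w) => //.
  by rewrite -level_proper e properxx.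
by rewrite -level_proper e properxx.
Qed.

Lemma colset_threshold j : colset A j = L (g j).
Proof. by apply/setP=> i; rewrite !inE mxE. Qed.

Lemma colsets_threshold : colsets A = [set L v | v : 'I_J].
Proof.
apply/setP=> S; apply/imsetP/imsetP=> [[j _ ->]|[v _ ->]].
  by exists (g j); rewrite ?colset_threshold.
by have /ontoP/(_ v)[j <-] := gP; exists j; rewrite ?colset_threshold.
Qed.

Lemma card_colsets_threshold : #|colsets A| = J.
Proof. by rewrite colsets_threshold card_imset ?card_ord //; apply: level_inj. Qed.

Lemma card_colsets_filter (P : pred {set 'I_n}) m :
  m <= J -> (forall v, P (L v) = (v < m)) -> #|[set S in colsets A | P S]| = m.
Proof.
move=> lemJ PL.
have -> : [set S in colsets A | P S] = [set L (widen_ord lemJ v) | v : 'I_m].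
  rewrite colsets_threshold; apply/setP=> S; rewrite inE.
  apply/andP/imsetP => [[/imsetP[v _ ->]]|[v _ ->]].
    by rewrite PL => ltv; exists (Ordinal ltv) => //; congr L; apply: val_inj.
  by rewrite imset_f ?PL /=.
rewrite card_imset ?card_ord // => v w /level_inj/(congr1 val) e.
exact: val_inj.
Qed.

Lemma depth_threshold j : depth A j = g j.
Proof.
apply: card_colsets_filter; first exact: ltnW.
by move=> v; rewrite colset_threshold level_proper.
Qed.

Lemma height_threshold i : height A i = f i.
Proof.
apply: card_colsets_filter; first by rewrite -ltnS.
by move=> v; rewrite inE.
Qed.

Lemma cols_nonzero_threshold : cols_nonzero A.
Proof.
apply/forallP=> j; apply/existsP.
have /onto_butP/(_ (lift ord0 (g j)) isT)[i fi] := fP.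
by exists i; rewrite mxE fi.
Qed.

Lemma rows_nonzero_threshold : rows_nonzero A = (ord0 \notin codom f).
Proof.
apply/forallP/idP => [nz|f0 i].
  apply/codomP=> -[i fi]; have /existsP[j] := nz i.
  by rewrite mxE /= -fi.
have fi : 0 < f i.
  by rewrite lt0n; apply: contraNneq f0 => e; apply/codomP; exists i; apply: val_inj.
have J0 : 0 < J by apply: leq_trans fi _; rewrite -ltnS.
have /ontoP/(_ (Ordinal J0))[j gj] := gP.
by apply/existsP; exists j; rewrite mxE gj.
Qed.

End Levels.

Lemma threshold_inj J :
  {in [set p : {ffun 'I_n -> 'I_J.+1} * {ffun 'I_k -> 'I_J} |
         onto_but ord0 p.1 && onto p.2] &, injective (@threshold J)}.
Proof.
move=> [f g] [f' g']; rewrite !inE /= => /andP[fP gP] /andP[fP' gP'] e.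
congr (_, _); apply/ffunP=> x; apply: val_inj.
  by rewrite /= -(height_threshold fP gP) e height_threshold.
by rewrite /= -(depth_threshold fP gP) e depth_threshold.
Qed.

(** The matrices are sorted according to their number J of distinct columns, and
those with a given J correspond to the pairs (height, depth).  The predicates
[P] and [Q] allow one bijection to serve both with and without the condition
that all rows are nonzero, which only concerns the heights. *)
Lemma card_threshold (P : pred 'M[bool]_(n, k))
    (Q : forall J, pred {ffun 'I_n -> 'I_J.+1}) :
    (forall J f g, onto_but ord0 f -> onto g -> P (@threshold J (f, g)) = Q J f) ->
  #|[set A | [&& lonesum A, cols_nonzero A & P A]]| =
  \sum_(J < k.+1) #|[set f | onto_but ord0 f && Q J f]| * surjections k J.
Proof.
move=> PQ; rewrite -sum1dep_card.
have lec (A : 'M_(n, k)) : #|colsets A| < k.+1.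
  by rewrite ltnS -[k in _ <= k]card_ord leq_imset_card.
rewrite (partition_big (fun A => Ordinal (lec A)) xpredT) //=.
apply: eq_bigr => J _; rewrite sum1dep_card -cardsX.
rewrite -(card_in_imset (f := @threshold J)); last first.
  move=> [f g] [f' g']; rewrite !in_setX !inE => /andP[/andP[fP _] gP] /andP[/andP[fP' _] gP'].
  by apply: threshold_inj; rewrite inE /= ?fP ?fP'.
congr #|pred_of_set _|; apply/setP=> A; rewrite inE.
apply/idP/imsetP => [/andP[/and3P[loneA nzA PA] /eqP eJ]|[[f g]]].
  have {}eJ : #|colsets A| = J by rewrite -eJ.
  have hlt i : height A i < J.+1 by rewrite -eJ height_lt.
  have dlt j : depth A j < J by rewrite -eJ depth_lt.
  pose f := [ffun i => Ordinal (hlt i)]; pose g := [ffun j => Ordinal (dlt j)].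
  have fP : onto_but ord0 f.
    apply/onto_butP=> w w0; have [|i hi] := @height_onto_but A w loneA nzA.
      by rewrite lt0n w0 eJ -ltnS ltn_ord.
    by exists i; apply: val_inj; rewrite ffunE.
  have gP : onto g.
    apply/ontoP=> v; have [|j dj] := @depth_onto A v loneA; first by rewrite eJ.
    by exists j; apply: val_inj; rewrite ffunE.
  have AE : A = threshold (f, g).
    by apply/matrixP=> i j; rewrite mxE !ffunE; apply: lonesum_depth_height.
  by exists (f, g) => //; rewrite in_setX !inE fP gP -(PQ J f g) // -AE PA.
rewrite in_setX !inE => /andP[/andP[fP Qf] gP] ->.
rewrite PQ // Qf cols_nonzero_threshold //= andbT -val_eqE /=.
rewrite card_colsets_threshold // eqxx andbT.
by apply: threshold_lonesum => i j; rewrite mxE.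
Qed.

End Threshold.

(** * The recurrence *)

Lemma lonesumC_surjections n k :
  lonesumC n k =
  \sum_(J < k.+1) (surjections n J + surjections n J.+1) * surjections k J.
Proof.
transitivity #|[set A : 'M[bool]_(n, k) | [&& lonesum A, cols_nonzero A & true]]|.
  by apply: eq_card => A; rewrite !inE andbT.
rewrite (@card_threshold _ _ _ (fun _ => xpredT)) //; apply: eq_bigr => J _.
congr (_ * _); rewrite -(card_onto_but n ord0).
by apply: eq_card => f; rewrite !inE andbT.
Qed.

Lemma lonesumD_surjections n k :
  lonesumD n k = \sum_(J < k.+1) surjections n J * surjections k J.
Proof.
rewrite /lonesumD (@card_threshold _ _ _ (fun J f => ord0 \notin codom f)); last first.
  by move=> J f g fP gP; rewrite rows_nonzero_threshold.
by apply: eq_bigr => J _; rewrite card_onto_but_miss.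
Qed.

Theorem theorem18 (n k : nat) (hn : 1 <= n) :
  lonesumC n k = lonesumD n k + lonesumD (n - 1) k + lonesumD (n - 1) k.+1.
Proof.
case: n hn => // n _; rewrite subn1 /= lonesumC_surjections !lonesumD_surjections.
under eq_bigr do rewrite mulnDl.
rewrite big_split /= -addnA; congr (_ + _).
rewrite [X in _ = _ + X]big_ord_recl /= surjectionsS0 muln0 add0n.
under eq_bigr do rewrite surjectionsSS.
under [X in _ = _ + X]eq_bigr do rewrite /bump /= add1n surjectionsSS.
(* The index shift loses nothing: the term J = 0 on the right vanishes because
   of its factor J, the last one on the left because there is no surjection
   from k points onto k+1. *)
have shift : \sum_(J < k.+1) J.+1 * (surjections n J.+1 * surjections k J.+1) =
             \sum_(J < k.+1) J * (surjections n J * surjections k J).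
  rewrite big_ord_recr /= (surjections_eq0 (ltnSn k)) !muln0 addn0.
  by rewrite [RHS]big_ord_recl mul0n add0n.
transitivity (\sum_(J < k.+1) surjections n J * surjections k J +
  (\sum_(J < k.+1) J * (surjections n J * surjections k J) +
   \sum_(J < k.+1) J.+1 * (surjections n J.+1 * surjections k J))); last first.
  rewrite -shift -big_split /=; congr (_ + _); apply: eq_bigr => J _; ring.
rewrite -!big_split /=; apply: eq_bigr => J _; ring.
Qed.
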